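(* Let $\Sigma$ be the discrete-time control-affine system $x_{t+1}=f(x_t)+Gu_t$, $y_t=h(x_t)+Ju_t$ described in the context, with set of assignable equilibria $\mathcal{E}_\Sigma$, and let $\mathsf{w}$ be the quadratic supply rate with parameters $(Q,S,R)$ described in the context. Let $P=P^{\mathsf T}\in\mathbb{R}^{n\times n}$ be positive semidefinite, and for $\bar x\in\mathcal{E}_\Sigma$ let $V_{\bar x}(x):=\|x-\bar x\|_P^2$, where $\|z\|_P^2:=z^{\mathsf T}Pz$. Then $\Sigma$ is EID with respect to $\mathsf{w}$ with storage functions $V_{\bar x}$, $\bar x\in\mathcal{E}_\Sigma$, if and only if there exist an integer $k>0$, a matrix $W\in\mathbb{R}^{k\times m}$ and a continuous function $\ell:\mathcal{X}\times\mathcal{X}\to\mathbb{R}^k$ such that, for all $(x,\bar x)\in\mathcal{X}\times\mathcal{E}_\Sigma$, $$\|f(x)-f(\bar x)\|_P^2-\|x-\bar x\|_P^2=-\|\ell(x,\bar x)\|_2^2+[h(x)-h(\bar x)]^{\mathsf T}Q[h(x)-h(\bar x)],$$ $$[f(x)-f(\bar x)]^{\mathsf T}PG=[h(x)-h(\bar x)]^{\mathsf T}(QJ+S)-\ell(x,\bar x)^{\mathsf T}W,$$ $$W^{\mathsf T}W=\widehat R-G^{\mathsf T}PG,$$ where $\widehat R=R+J^{\mathsf T}S+S^{\mathsf T}J+J^{\mathsf T}QJ$. Moreover, the function $\ell$ in these equations may always be chosen to have the form $$\ell(x,\bar x)=l(x)-l(\bar x)+T\,q(x,\bar x),$$ where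 $l:\mathcal{X}\to\mathbb{R}^k$, the columns of $T\in\mathbb{R}^{k\times r}$ with $r=\dim(\ker(W^{\mathsf T}))$ form a basis of $\ker(W^{\mathsf T})$, and $q:\mathcal{X}\times\mathcal{X}\to\mathbb{R}^r$ satisfies $q(x,x)=0$ for all $x\in\mathcal{X}$.
   Context: System: $x_{t+1}=f(x_t)+Gu_t$, $y_t=h(x_t)+Ju_t$, $t\in\mathbb{Z}_{\ge0}$, with $x_t\in\mathcal{X}=\mathbb{R}^n$, $u_t\in\mathcal{U}=\mathbb{R}^m$, $y_t\in\mathcal{Y}=\mathbb{R}^p$, $m,p\le n$; $f:\mathcal{X}\to\mathbb{R}^n$ and $h:\mathcal{X}\to\mathcal{Y}$ are sufficiently smooth maps; $G\in\mathbb{R}^{n\times m}$ is constant with rank $m$; $J\in\mathbb{R}^{p\times m}$ is constant. Equilibria: $\mathcal{E}_\Sigma=\{\bar x\in\mathcal{X}:\exists\,\bar u\in\mathcal{U},\ \bar x=f(\bar x)+G\bar u\}$. For $\bar x\in\mathcal{E}_\Sigma$ the unique equilibrium input and output are $\bar u=k_u(\bar x)=(G^{\mathsf T}G)^{-1}G^{\mathsf T}(\bar x-f(\bar x))$ and $\bar y=k_y(\bar x)=h(\bar x)+J\bar u$. Supply rate: $\mathsf{w}(u,y)=\begin{bmatrix} y \\ u \end{bmatrix}^{\mathsf T}\begin{bmatrix} Q & S \\ S^{\mathsf T} & R \end{bmatrix}\begin{bmatrix} y \\ u \end{bmatrix}$ with $Q=Q^{\mathsf T}\in\mathbb{R}^{p\times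 p}$, $S\in\mathbb{R}^{p\times m}$, $R=R^{\mathsf T}\in\mathbb{R}^{m\times m}$, the block matrix being sign-indefinite. EID (equilibrium-independent dissipative) with supply rate $\mathsf{w}$ and storage functions $V_{\bar x}:\mathcal{X}\to\mathbb{R}_{\ge0}$, $\bar x\in\mathcal{E}_\Sigma$: for every $\bar x\in\mathcal{E}_\Sigma$, with $\bar u=k_u(\bar x)$, $\bar y=k_y(\bar x)$, one has $V_{\bar x}(\bar x)=0$ and $V_{\bar x}(x_{t+1})-V_{\bar x}(x_t)\le\mathsf{w}(u_t-\bar u,y_t-\bar y)$ for all $t\in\mathbb{Z}_{\ge0}$, along all trajectories (all initial conditions and all inputs $u\in\ell_{2e}^m[0,\infty)$, i.e. arbitrary input sequences). *)

(* Defs.v *)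
From HB Require Import structures.
From mathcomp Require Import all_boot all_order all_algebra.
From mathcomp Require Import all_classical all_reals all_analysis.

Set Implicit Arguments.
Unset Strict Implicit.
Unset Printing Implicit Defensive.

Import Order.TTheory GRing.Theory Num.Theory.
Import numFieldNormedType.Exports.

Local Open Scope classical_set_scope.
Local Open Scope ring_scope.

(* The discrete-time control-affine system
     x_(t+1) = f(x_t) + G u_t,   y_t = h(x_t) + J u_t. *)
Record system (R : realType) (n m p : nat) := System {
  sys_f : 'cV[R]_n -> 'cV[R]_n ;
  sys_h : 'cV[R]_n -> 'cV[R]_p ;
  sys_G : 'M[R]_(n, m) ;
  sys_J : 'M[R]_(p, m)
}.

(* z^T M z, also written ||z||_M^2. *)
Definition qform (R : realType) (n : nat) (M : 'M[R]_n) (z : 'cV[R]_n) : R :=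
  (z^T *m M *m z) 0 0.

(* The squared Euclidean norm; `|z| on matrices is the sup norm. *)
Definition sqnorm2 (R : realType) (n : nat) (z : 'cV[R]_n) : R :=
  \sum_i z i 0 ^+ 2.

Definition symmetric_mx (R : realType) (n : nat) (M : 'M[R]_n) : Prop :=
  M^T = M.

Definition psd_mx (R : realType) (n : nat) (M : 'M[R]_n) : Prop :=
  symmetric_mx M /\ forall z, 0 <= qform M z.

Definition sign_indefinite (R : realType) (n : nat) (M : 'M[R]_n) : Prop :=
  (exists z, 0 < qform M z) /\ (exists z, qform M z < 0).

Definition supply_mx (R : realType) (m p : nat)
    (Qm : 'M[R]_p) (Sm : 'M[R]_(p, m)) (Rm : 'M[R]_m) : 'M[R]_(p + m) :=
  block_mx Qm Sm Sm^T Rm.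

Definition supply_rate (R : realType) (m p : nat)
    (Qm : 'M[R]_p) (Sm : 'M[R]_(p, m)) (Rm : 'M[R]_m)
    (u : 'cV[R]_m) (y : 'cV[R]_p) : R :=
  qform (supply_mx Qm Sm Rm) (col_mx y u).

Definition equilibria (R : realType) (n m p : nat) (Sys : system R n m p) :
    set 'cV[R]_n :=
  [set xbar | exists ubar : 'cV[R]_m, xbar = sys_f Sys xbar + sys_G Sys *m ubar].

Definition eq_input (R : realType) (n m p : nat) (Sys : system R n m p)
    (xbar : 'cV[R]_n) : 'cV[R]_m :=
  invmx ((sys_G Sys)^T *m sys_G Sys) *m (sys_G Sys)^T *m (xbar - sys_f Sys xbar).

Definition eq_output (R : realType) (n m p : nat) (Sys : system R n m p)
    (xbar : 'cV[R]_n) : 'cV[R]_p :=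
  sys_h Sys xbar + sys_J Sys *m eq_input Sys xbar.

Definition trajectory (R : realType) (n m p : nat) (Sys : system R n m p)
    (x : nat -> 'cV[R]_n) (u : nat -> 'cV[R]_m) (y : nat -> 'cV[R]_p) : Prop :=
  forall t : nat,
    x t.+1 = sys_f Sys (x t) + sys_G Sys *m u t /\
    y t = sys_h Sys (x t) + sys_J Sys *m u t.

(* Equilibrium-independent dissipativity with supply rate w and storage
   functions V xbar; only the values of V at equilibria xbar matter. *)
Definition EID (R : realType) (n m p : nat) (Sys : system R n m p)
    (w : 'cV[R]_m -> 'cV[R]_p -> R) (V : 'cV[R]_n -> 'cV[R]_n -> R) : Prop :=
  forall xbar, equilibria Sys xbar ->
    [/\ forall x, 0 <= V xbar x,
        V xbar xbar = 0 &
        forall x u y, trajectory Sys x u y ->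
          forall t : nat,
            V xbar (x t.+1) - V xbar (x t) <=
            w (u t - eq_input Sys xbar) (y t - eq_output Sys xbar)].

Definition Rhat (R : realType) (m p : nat)
    (Qm : 'M[R]_p) (Sm : 'M[R]_(p, m)) (Rm : 'M[R]_m) (J : 'M[R]_(p, m)) :
    'M[R]_m :=
  Rm + J^T *m Sm + Sm^T *m J + J^T *m Qm *m J.

(* The last equation does not depend on (x, xbar), but it is kept under the
   quantifier over equilibria: if there is no equilibrium then EID holds
   vacuously, while Rhat - G^T P G need not be of the form W^T W. *)
Definition eid_equations (R : realType) (n m p : nat) (Sys : system R n m p)
    (Qm : 'M[R]_p) (Sm : 'M[R]_(p, m)) (Rm : 'M[R]_m) (P : 'M[R]_n)
    (k : nat) (W : 'M[R]_(k, m))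
    (ell : 'cV[R]_n -> 'cV[R]_n -> 'cV[R]_k) : Prop :=
  let f := sys_f Sys in let h := sys_h Sys in
  let G := sys_G Sys in let J := sys_J Sys in
  forall x xbar : 'cV[R]_n, equilibria Sys xbar ->
    [/\ qform P (f x - f xbar) - qform P (x - xbar)
          = - sqnorm2 (ell x xbar) + qform Qm (h x - h xbar),
        (f x - f xbar)^T *m P *m G
          = (h x - h xbar)^T *m (Qm *m J + Sm) - (ell x xbar)^T *m W &
        W^T *m W = Rhat Qm Sm Rm J - G^T *m P *m G].

(* Joint continuity on the product space. *)
Definition continuous2 (R : realType) (n k : nat)
    (ell : 'cV[R]_n -> 'cV[R]_n -> 'cV[R]_k) : Prop :=
  continuous (fun z : 'cV[R]_n * 'cV[R]_n => ell z.1 z.2).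

(* kermx is the left kernel, as a row space; hence the transpositions in the
   next two definitions, which are about {z | A *m z = 0} for column vectors. *)
Definition ker_dim (R : realType) (a b : nat) (A : 'M[R]_(a, b)) : nat :=
  \rank (kermx A^T).

Definition columns_basis_ker (R : realType) (a b r : nat)
    (A : 'M[R]_(a, b)) (T : 'M[R]_(b, r)) : bool :=
  row_free T^T && (T^T == kermx A^T)%MS.

(* Main.v *)
(* Fix an equilibrium xbar and let v be the deviation of the input from its
   equilibrium value. Supply rate minus storage increment is a quadratic
   polynomial in v, namely a + 2 <b, v> + v^T C v with a and b depending on
   (x, xbar) and C constant; EID says that it is nonnegative for all v, and the
   three equations say that it equals |ell + W v|^2.

   If the polynomial is nonnegative then C is positive semidefinite (take
   x = xbar), so C = W0^T W0, and completing the square gives b = C c with c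
   linear in b and c^T C c <= a. Take W = (W0; 0) and ell = (W0 c; s), with
   s = sqrt (a - c^T C c). As sqrt is 0 on negative numbers, this ell is
   continuous on the whole product space, not only over equilibria.

   For the decomposition, b(x, xbar) = beta(x) - beta(xbar), so that
   l := (W^T)^+ beta solves W^T (l(x) - l(xbar)) = b(x, xbar) = W^T ell. Hence
   ell - (l(x) - l(xbar)) = T d over equilibria, with d := T^+ (ell - l + l).
   Then q(x, xbar) := d(x, xbar) - d(xbar, xbar) vanishes on the whole diagonal
   and agrees with d over equilibria, where ell(xbar, xbar) = 0. *)
Require Import Defs.
From HB Require Import structures.
From mathcomp Require Import all_boot all_order all_algebra.
From mathcomp Require Import all_classical all_reals all_analysis.
From mathcomp Require Import ring lra.

Set Implicit Arguments.
Unset Strict Implicit.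
Unset Printing Implicit Defensive.

Import Order.TTheory GRing.Theory Num.Theory.
Import numFieldNormedType.Exports.

Local Open Scope classical_set_scope.
Local Open Scope ring_scope.

(** * Euclidean inner product and quadratic forms on column vectors *)

Definition dot (R : realType) (n : nat) (u v : 'cV[R]_n) : R := (u^T *m v) 0 0.

Lemma dotE (R : realType) n (u v : 'cV[R]_n) : dot u v = \sum_i u i 0 * v i 0.
Proof. by rewrite /dot mxE; apply: eq_bigr => i _; rewrite mxE. Qed.

Lemma dotC (R : realType) n (u v : 'cV[R]_n) : dot u v = dot v u.
Proof. by rewrite !dotE; apply: eq_bigr => i _; rewrite mulrC. Qed.

Lemma dotDr (R : realType) n (u v w : 'cV[R]_n) :
  dot u (v + w) = dot u v + dot u w.
Proof. by rewrite /dot mulmxDr mxE. Qed.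

Lemma dotNr (R : realType) n (u v : 'cV[R]_n) : dot u (- v) = - dot u v.
Proof. by rewrite /dot mulmxN mxE. Qed.

Lemma dotZr (R : realType) n a (u v : 'cV[R]_n) : dot u (a *: v) = a * dot u v.
Proof. by rewrite /dot -scalemxAr mxE. Qed.

Lemma dotDl (R : realType) n (u v w : 'cV[R]_n) :
  dot (u + v) w = dot u w + dot v w.
Proof. by rewrite dotC dotDr !(dotC w). Qed.

Lemma dotNl (R : realType) n (u v : 'cV[R]_n) : dot (- u) v = - dot u v.
Proof. by rewrite dotC dotNr dotC. Qed.

Lemma dotZl (R : realType) n a (u v : 'cV[R]_n) : dot (a *: u) v = a * dot u v.
Proof. by rewrite dotC dotZr dotC. Qed.

Lemma dot0l (R : realType) n (u : 'cV[R]_n) : dot 0 u = 0.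
Proof. by rewrite /dot trmx0 mul0mx mxE. Qed.

Lemma dot_mull (R : realType) m n (A : 'M[R]_(n, m)) u v :
  dot (A *m u) v = dot u (A^T *m v).
Proof. by rewrite /dot trmx_mul mulmxA. Qed.

Lemma dot_col_mx (R : realType) m n (u1 v1 : 'cV[R]_m) (u2 v2 : 'cV[R]_n) :
  dot (col_mx u1 u2) (col_mx v1 v2) = dot u1 v1 + dot u2 v2.
Proof. by rewrite /dot tr_col_mx mul_row_col mxE. Qed.

Lemma dot_ge0 (R : realType) n (u : 'cV[R]_n) : 0 <= dot u u.
Proof. by rewrite dotE sumr_ge0 // => i _; rewrite -expr2 sqr_ge0. Qed.

Lemma dot_eq0 (R : realType) n (u : 'cV[R]_n) : dot u u = 0 -> u = 0.
Proof.
rewrite dotE => /psumr_eq0P u0; apply/colP => i; rewrite mxE; apply/eqP.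
by rewrite -sqrf_eq0 expr2 u0 // => j _; rewrite -expr2 sqr_ge0.
Qed.

Lemma sqnorm2E (R : realType) n (u : 'cV[R]_n) : sqnorm2 u = dot u u.
Proof. by rewrite /sqnorm2 dotE; apply: eq_bigr => i _; rewrite expr2. Qed.

Lemma qformE (R : realType) n (M : 'M[R]_n) u : qform M u = dot u (M *m u).
Proof. by rewrite /qform /dot mulmxA. Qed.

Lemma qform0 (R : realType) n (M : 'M[R]_n) : qform M 0 = 0.
Proof. by rewrite qformE dot0l. Qed.

Lemma qform_mulmx (R : realType) m n (M : 'M[R]_n) (A : 'M[R]_(n, m)) v :
  qform M (A *m v) = qform (A^T *m M *m A) v.
Proof. by rewrite !qformE dot_mull !mulmxA. Qed.

Lemma qformD (R : realType) n (M : 'M[R]_n) u v : symmetric_mx M ->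
  qform M (u + v) = qform M u + 2 * dot (M *m u) v + qform M v.
Proof.
move=> symM; rewrite !qformE mulmxDr !dotDl !dotDr [dot v (M *m u)]dotC.
rewrite !(dotC v) !dot_mull symM; ring.
Qed.

Lemma qformZ (R : realType) n (M : 'M[R]_n) a u :
  qform M (a *: u) = a ^+ 2 * qform M u.
Proof. by rewrite !qformE -scalemxAr dotZl dotZr; ring. Qed.

(** * Nonnegative quadratic polynomials and factorization of semidefinite matrices *)

Lemma affine_ge0_slope0 (R : realType) (a b : R) :
  (forall t, 0 <= a + t * b) -> b = 0.
Proof.
(* For nonzero [b] this [t] gives the value -1. *)
move=> ab; apply: contrapT => /eqP b0; move: (ab (- (a + 1) / b)).
by rewrite mulfVK //; lra.
Qed.

(* Completing the square: at [v = - c], where [c := (pinvmx M)^T *m b] solves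
   [M *m c = b], the polynomial takes its minimal value [a - qform M c]. *)
Lemma quadratic_ge0 (R : realType) n (M : 'M[R]_n) (a : R) (b : 'cV[R]_n) :
  symmetric_mx M -> (forall v, 0 <= a + 2 * dot b v + qform M v) ->
  M *m ((pinvmx M)^T *m b) = b /\ qform M ((pinvmx M)^T *m b) <= a.
Proof.
move=> symM pos; set c := _ *m b.
have Mc : M *m c = b.
  (* Solvability amounts to [b] being orthogonal to every [w] with [M *m w = 0]: along multiples of
     such a [w] the polynomial is affine, so its slope [dot b w] is zero. *)
  have /mulmxKpV : (b^T <= M)%MS.
      rewrite submxE; move: (cokermx M) (mulmx_coker M) => K MK.
    apply/eqP/rowP => j; rewrite [RHS]mxE.
    pose w := K *m delta_mx j (0 : 'I_1).
    have -> : (b^T *m K) 0 j = dot b w.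
      by rewrite /dot /w mulmxA -colE [RHS]mxE.
    apply: (@affine_ge0_slope0 _ a) => t; have := pos ((t / 2) *: w).
    rewrite qformZ qformE mulmxA MK mul0mx [dot w 0]dotC dot0l dotZr.
    by rewrite mulrA [2 * _]mulrC divfK ?pnatr_eq0 // mulr0 addr0.
  by move/(congr1 trmx); rewrite trmxK trmx_mul [(b^T *m _)^T]trmx_mul symM
    trmxK.
split=> //; have := pos (- c).
by rewrite -scaleN1r qformZ -Mc scaleN1r dotNr qformE [dot (M *m c) c]dotC; lra.
Qed.

(* Cholesky factorization; for a zero pivot [d] positivity kills the whole
   column, so that the formulas below stay correct with [0^-1 = 0]. *)
Lemma psd_factor (R : realType) n (M : 'M[R]_n) :
  psd_mx M -> exists W : 'M[R]_n, W^T *m W = M.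
Proof.
elim: n M => [|n IH] M; first by exists 0; rewrite [RHS]flatmx0 [LHS]flatmx0.
rewrite -[n.+1]/(1 + n)%N in M * => -[symM posM].
pose d := M 0 0; pose b : 'cV_n := dlsubmx M; pose C := drsubmx M.
have ME : M = block_mx d%:M b^T b C.
  rewrite -[LHS]submxK; congr block_mx.
    by rewrite [LHS]mx11_scalar; congr (_%:M); rewrite !mxE; congr (M _ _);
      apply/val_inj.
  by rewrite trmx_dlsub symM.
have symC : C^T = C by rewrite trmx_drsub symM.
have qE t z : qform M (col_mx t%:M z) = d * t ^+ 2 + 2 * t * dot b z + dot z (C
  *m z).
  rewrite ME qformE mul_block_col dot_col_mx !dotDr -(scalemx1 _ t) -(scalemx1
    _ d).
  rewrite -!scalemxAr !mulmx1 !dotZr !dotZl [dot z b]dotC.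
  have -> : dot (1%:M : 'cV[R]_1) 1%:M = 1 by rewrite /dot trmx1 mulmx1 mxE.
  have -> : dot 1%:M (b^T *m z) = dot b z by rewrite /dot trmx1 mul1mx.
  by ring.
have d_ge0 : 0 <= d.
  by have := posM (col_mx 1%:M 0); rewrite qE dotC !dot0l; lra.
have b0 : d = 0 -> b = 0.
  (* At the vector [(t / 2; b)] the form is affine in [t] with slope [dot b b]. *)
  move=> d0; apply/dot_eq0/(@affine_ge0_slope0 _ (dot b (C *m b))) => t.
  by have := posM (col_mx (t / 2)%:M b); rewrite qE d0; lra.
(* The Schur complement of [d] is semidefinite: its form at [z] is that of [M] at [z] extended by
   the first coordinate [- d^-1 * dot b z], which is the minimizing one if [d] is nonzero. *)
have [U UE] : exists U : 'M[R]_n, U^T *m U = C - d^-1 *: (b *m b^T).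
  apply: IH; split; first by rewrite /symmetric_mx linearB linearZ /= trmx_mul
    trmxK symC.
  move=> z; have := posM (col_mx (- d^-1 * dot b z)%:M z); rewrite qE qformE.
  rewrite mulmxBl dotDr dotNr -scalemxAl dotZr -mulmxA.
  have -> : dot z (b *m (b^T *m z)) = dot b z ^+ 2.
    by rewrite -[b in b *m _]trmxK -dot_mull dotE big_ord1 expr2.
  have [d0|d0] := eqVneq d 0; first by rewrite d0 invr0; lra.
  suff -> : d * (- d^-1 * dot b z) ^+ 2 = d^-1 * dot b z ^+ 2 by lra.
  by field.
pose s := Num.sqrt d.
have ss : s * s = d by rewrite -expr2 sqr_sqrtr.
have sb : (s * s^-1) *: b = b.
  have [d0|d0] := eqVneq d 0; first by rewrite b0 // scaler0.
  by rewrite divff ?scale1r // sqrtr_eq0 -ltNge lt_neqAle eq_sym d0.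
exists (block_mx s%:M (s^-1 *: b^T) 0 U).
rewrite tr_block_mx mulmx_block ME tr_scalar_mx [(_ *: _)^T]linearZ /= trmxK
  trmx0 mul0mx addr0.
rewrite -scalar_mxM ss !mulmx0 !addr0 mul_scalar_mx mul_mx_scalar !scalerA
  mul0mx addr0.
congr block_mx => //; first by rewrite -[in RHS]sb linearZ.
rewrite UE -scalemxAl -scalemxAr scalerA -invfM ss; exact: subrKC.
Qed.

(** * Continuity of matrix-valued maps *)

Lemma continuous_coord (R : realType) (T : topologicalType) m n
    (F : T -> 'M[R]_(m, n)) :
  (forall i j, continuous (fun t => F t i j)) -> continuous F.
Proof.
(* [A] contains a box with one neighbourhood [P i j] per entry, and there are finitely many
   entries. *)
move=> cF t A [P FP sPA]; rewrite nbhs_simpl /=.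
suff : \forall s \near t, forall i j, P i j (F s i j).
  by apply: filterS => s; exact: sPA.
apply: filter_forall => i; apply: filter_forall => j.
exact: cF (FP i j).
Qed.

Lemma continuous_entry (R : realType) (T : topologicalType) m n
    (F : T -> 'M[R]_(m, n)) i j :
  continuous F -> continuous (fun t => F t i j).
Proof.
by move=> cF t; exact: (continuous_comp (cF t) (@coord_continuous _ _ _ i j _)).
Qed.

Lemma continuous_mulmx (R : realType) (T : topologicalType) m n k
    (F : T -> 'M[R]_(m, n)) (H : T -> 'M[R]_(n, k)) :
  continuous F -> continuous H -> continuous (fun t => F t *m H t).
Proof.
move=> cF cH; apply: continuous_coord => i j.
under eq_fun do rewrite mxE.
apply: continuous_big; first exact: add_continuous.
by move=> l _ t; apply: cvgM; exact: continuous_entry.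
Qed.

Lemma continuous_mulmxl (R : realType) (T : topologicalType) m n k
    (A : 'M[R]_(m, n)) (F : T -> 'M[R]_(n, k)) :
  continuous F -> continuous (fun t => A *m F t).
Proof. by move=> cF; apply: continuous_mulmx => // t; exact: cvg_cst. Qed.

Lemma continuous_qform (R : realType) (T : topologicalType) k (M : 'M[R]_k)
    (F : T -> 'cV[R]_k) :
  continuous F -> continuous (fun t => qform M (F t)).
Proof.
move=> cF; have cMF := continuous_mulmxl (A := M) cF.
under eq_fun do rewrite qformE dotE.
apply: continuous_big; first exact: add_continuous.
move=> i _ t; apply: cvgM; first exact: continuous_entry cF _.
exact: continuous_entry cMF _.
Qed.

Lemma continuous_subr (R : realType) (T : topologicalType) m n
    (F H : T -> 'M[R]_(m, n)) :
  continuous F -> continuous H -> continuous (fun t => F t - H t).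
Proof. by move=> cF cH t; exact: (cvgB (cF t) (cH t)). Qed.

Lemma continuous2_diff (R : realType) n k (F : 'cV[R]_n -> 'cV[R]_k) :
  continuous F -> continuous2 (fun x y => F x - F y).
Proof.
move=> cF; apply: (@continuous_subr _ _ _ _ (fun z => F z.1) (fun z => F z.2)).
  by move=> z; exact: (@continuous_comp _ _ _ fst F z cvg_fst (cF z.1)).
by move=> z; exact: (@continuous_comp _ _ _ snd F z cvg_snd (cF z.2)).
Qed.

(** * The dissipation inequality as a quadratic polynomial in the input deviation *)

Section Dissipation.
Context (R : realType) (n m p : nat) (Sys : system R n m p).
Context (Qm : 'M[R]_p) (Sm : 'M[R]_(p, m)) (Rm : 'M[R]_m) (P : 'M[R]_n).

Let f := sys_f Sys.
Let h := sys_h Sys.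
Let G := sys_G Sys.
Let J := sys_J Sys.

(* For [v] the deviation of the input from its equilibrium value, supply rate
   minus storage increment is [diss_const x xbar + 2 * dot (diss_lin x xbar) v +
   qform diss_quad v]. *)
Definition diss_const (x xbar : 'cV[R]_n) : R :=
  qform Qm (h x - h xbar) - qform P (f x - f xbar) + qform P (x - xbar).

Definition diss_lin (x xbar : 'cV[R]_n) : 'cV[R]_m :=
  (Qm *m J + Sm)^T *m (h x - h xbar) - G^T *m P *m (f x - f xbar).

Definition diss_quad : 'M[R]_m := Rhat Qm Sm Rm J - G^T *m P *m G.

Lemma supply_rateE (u : 'cV[R]_m) (y : 'cV[R]_p) :
  supply_rate Qm Sm Rm u y = qform Qm y + 2 * dot (Sm^T *m y) u + qform Rm u.
Proof.
rewrite /supply_rate /supply_mx qformE mul_block_col dot_col_mx !dotDr -!qformE.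
rewrite [dot u (Sm^T *m y)]dotC.
have -> : dot y (Sm *m u) = dot (Sm^T *m y) u by rewrite dot_mull trmxK.
by ring.
Qed.

Lemma dissipation_expand (symQ : symmetric_mx Qm) (symP : symmetric_mx P)
    (x xbar : 'cV[R]_n) (v : 'cV[R]_m) :
  supply_rate Qm Sm Rm v (h x - h xbar + J *m v)
    - (qform P (f x - f xbar + G *m v) - qform P (x - xbar)) =
  diss_const x xbar + 2 * dot (diss_lin x xbar) v + qform diss_quad v.
Proof.
rewrite supply_rateE /diss_const /diss_lin.
move: (h x - h xbar) (f x - f xbar) (x - xbar) => b a e.
rewrite !qformD // mulmxDr !qform_mulmx !dotDl !dotNl [(_ + _)^T]linearD /=
  mulmxDl dotDl.
rewrite trmx_mul symQ -!mulmxA.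
have -> : dot (Qm *m b) (J *m v) = dot (J^T *m (Qm *m b)) v
  by rewrite [RHS]dot_mull trmxK.
have -> : dot (P *m a) (G *m v) = dot (G^T *m (P *m a)) v
  by rewrite [RHS]dot_mull trmxK.
have -> : qform diss_quad v = qform Rm v + 2 * dot (Sm^T *m (J *m v)) v
    + qform (J^T *m (Qm *m J)) v - qform (G^T *m (P *m G)) v.
  rewrite /diss_quad /Rhat !qformE !mulmxBl !mulmxDl !dotDr !dotNr -!mulmxA.
  rewrite [dot (Sm^T *m _) v]dotC [dot v (J^T *m (Sm *m v))]dotC.
  have -> : dot (J^T *m (Sm *m v)) v = dot v (Sm^T *m (J *m v)).
    by rewrite !dot_mull trmxK.
  by ring.
by ring.
Qed.

Lemma diss_quad_sym (symQ : symmetric_mx Qm) (symR : symmetric_mx Rm)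
  (symP : symmetric_mx P) : symmetric_mx diss_quad.
Proof.
rewrite /symmetric_mx /diss_quad /Rhat linearB /= !linearD /= !trmx_mul !trmxK.
by rewrite symQ symR symP !mulmxA; congr (_ + _ - _); rewrite addrAC.
Qed.

(** This form matches the coefficients of the polynomial with those of [|ell + W v|^2]. The second
    equation is transposed, using the symmetry of [P]. *)
Lemma eid_equationsP k (W : 'M[R]_(k, m)) ell : symmetric_mx P ->
  eid_equations Sys Qm Sm Rm P W ell <->
  forall x xbar, equilibria Sys xbar ->
    [/\ sqnorm2 (ell x xbar) = diss_const x xbar,
        W^T *m ell x xbar = diss_lin x xbar & W^T *m W = diss_quad].
Proof.
move=> symP; rewrite /eid_equations /= -/f -/h -/G -/J.
have eqB x xbar :
    (f x - f xbar)^T *m P *m G =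
      (h x - h xbar)^T *m (Qm *m J + Sm) - (ell x xbar)^T *m W <->
    W^T *m ell x xbar = diss_lin x xbar.
  rewrite /diss_lin; move: (f x - f xbar) (h x - h xbar) => a b.
  have -> : a^T *m P *m G = (G^T *m P *m a)^T.
    by rewrite !trmx_mul trmxK symP mulmxA.
  have -> : b^T *m (Qm *m J + Sm) = ((Qm *m J + Sm)^T *m b)^T.
    by rewrite trmx_mul trmxK.
  have -> : (ell x xbar)^T *m W = (W^T *m ell x xbar)^T.
    by rewrite trmx_mul trmxK.
  by rewrite -linearB /=; split=> [/trmx_inj ->|->]; rewrite subKr.
split=> eqs x xbar /(eqs x)[eA /eqB eB eC]; split=> //.
  by rewrite /diss_const; lra.
by rewrite eA /diss_const; ring.
Qed.

(** Full column rank makes [G^T *m G] invertible, so the least-squares formula returns the very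
    input that witnesses the equilibrium. *)
Lemma eq_inputP (rank_G : \rank G = m) xbar :
  equilibria Sys xbar -> f xbar + G *m eq_input Sys xbar = xbar.
Proof.
case=> ubar E; have GGu : G^T *m G \in unitmx.
  rewrite -row_free_unit -kermx_eq0; apply/rowV0P => w /sub_kermxP wGG.
  have Gw : G *m w^T = 0.
    by apply: dot_eq0; rewrite dot_mull /dot trmxK !mulmxA -(mulmxA w) wGG
      mul0mx mxE.
  have : w *m G^T = 0 by apply: trmx_inj; rewrite trmx_mul trmxK Gw trmx0.
  by move/eqP; rewrite mulmx_free_eq0 ?/row_free ?mxrank_tr ?rank_G // => /eqP.
have Gu : xbar - f xbar = G *m ubar by rewrite {1}E addrC addKr.
have -> : eq_input Sys xbar = ubar.
  by rewrite /eq_input -/f -/G Gu -!mulmxA [G^T *m (_ *m _)]mulmxA mulKmx.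
exact/esym.
Qed.

Lemma next_state_dev (rank_G : \rank G = m) xbar x u :
  equilibria Sys xbar ->
  f x + G *m u - xbar = f x - f xbar + G *m (u - eq_input Sys xbar).
Proof.
move=> Exbar; rewrite -[in LHS](eq_inputP rank_G Exbar).
by rewrite mulmxBr opprD addrACA.
Qed.

Lemma output_dev xbar x u :
  h x + J *m u - eq_output Sys xbar =
  h x - h xbar + J *m (u - eq_input Sys xbar).
Proof. by rewrite /eq_output mulmxBr opprD addrACA. Qed.

(** Any state [x] and deviation [v] occur at time 0 of a trajectory with constant input, so
    dissipation along trajectories is a pointwise condition. *)
Lemma EIDP (rank_G : \rank G = m) (symQ : symmetric_mx Qm) (psdP : psd_mx P) :
  EID Sys (supply_rate Qm Sm Rm) (fun xbar x => qform P (x - xbar)) <->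
  forall x xbar v, equilibria Sys xbar ->
    0 <= diss_const x xbar + 2 * dot (diss_lin x xbar) v + qform diss_quad v.
Proof.
case: psdP => symP posP; split=> [eid x xbar v Exbar|pos xbar Exbar];
  last first.
  split=> [z||x u y tr t]; rewrite ?subrr ?qform0 //.
  have [-> ->] := tr t; rewrite -subr_ge0 -/f -/G -/h -/J.
  rewrite next_state_dev // output_dev dissipation_expand //; exact: pos.
rewrite -dissipation_expand //.
pose u := v + eq_input Sys xbar.
pose xs := fix xs t := if t is t'.+1 then f (xs t') + G *m u else x.
have [_ _ /(_ xs (fun=> u) (fun t => h (xs t) + J *m u))] := eid xbar Exbar.
move=> /(_ (fun=> conj erefl erefl) 0%N); rewrite -subr_ge0 /=.
by rewrite next_state_dev // output_dev addrK.
Qed.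

End Dissipation.

(** * The two implications, then the splitting of [ell] along the kernel of [W^T] *)

Theorem lemma5p3 (R : realType) (n m p : nat) (le_mn : (m <= n)%N)
    (le_pn : (p <= n)%N) (Sys : system R n m p)
    (cont_f : continuous (sys_f Sys)) (cont_h : continuous (sys_h Sys))
    (rank_G : \rank (sys_G Sys) = m)
    (Qm : 'M[R]_p) (Sm : 'M[R]_(p, m)) (Rm : 'M[R]_m)
    (sym_Q : symmetric_mx Qm) (sym_R : symmetric_mx Rm)
    (indef : sign_indefinite (supply_mx Qm Sm Rm))
    (P : 'M[R]_n) (psd_P : psd_mx P) :
  (EID Sys (supply_rate Qm Sm Rm) (fun xbar x => qform P (x - xbar)) <->
   exists (k : nat) (W : 'M[R]_(k, m))
          (ell : 'cV[R]_n -> 'cV[R]_n -> 'cV[R]_k),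
     [/\ (0 < k)%N, continuous2 ell & eid_equations Sys Qm Sm Rm P W ell])
  /\
  (forall (k : nat) (W : 'M[R]_(k, m))
          (ell : 'cV[R]_n -> 'cV[R]_n -> 'cV[R]_k),
     (0 < k)%N -> continuous2 ell -> eid_equations Sys Qm Sm Rm P W ell ->
     forall T : 'M[R]_(k, ker_dim W^T), columns_basis_ker W^T T ->
     exists (l : 'cV[R]_n -> 'cV[R]_k)
            (q : 'cV[R]_n -> 'cV[R]_n -> 'cV[R]_(ker_dim W^T)),
       (forall x, q x x = 0) /\
       let ell' := fun x xbar => l x - l xbar + T *m q x xbar in
       continuous2 ell' /\ eid_equations Sys Qm Sm Rm P W ell').
Proof.
have [symP posP] := psd_P.
have cB : continuous2 (diss_lin Sys Qm Sm P).
  have ch := continuous_mulmxl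
    (A := (Qm *m sys_J Sys + Sm)^T) (continuous2_diff cont_h).
  have cf := continuous_mulmxl
    (A := (sys_G Sys)^T *m P) (continuous2_diff cont_f).
  exact: continuous_subr ch cf.
split; first (rewrite EIDP //; split).
- move=> pos; pose M := diss_quad Sys Qm Sm Rm P.
  (* Positivity of [M] is tested at an equilibrium; if there is none, the equations are vacuous and
     zero data will do. *)
  have [[xb Exb]|noE] := pselect (exists xb, equilibria Sys xb); last first.
    exists 1%N, 0, (fun _ _ => 0); split=> //; first by move=> z;
      exact: cvg_cst.
    by move=> x xb Exb; case: noE; exists xb.
  have symM : symmetric_mx M by exact: diss_quad_sym.
  have psdM : psd_mx M.
    split=> // v; have := pos xb xb v Exb.
    by rewrite /diss_const /diss_lin !subrr !qform0 !mulmx0 !subrr dot0l mulr0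
      !add0r.
  have [W WE] := psd_factor psdM.
  pose c x xbar := (pinvmx M)^T *m diss_lin Sys Qm Sm P x xbar.
  pose g x xbar := diss_const Sys Qm P x xbar - qform M (c x xbar).
  pose s x xbar := Num.sqrt (g x xbar).
  have cc : continuous2 c by exact: continuous_mulmxl.
  have cg : continuous (fun z : 'cV[R]_n * 'cV[R]_n => g z.1 z.2).
    have qh := continuous_qform (M := Qm) (continuous2_diff cont_h).
    have qf := continuous_qform (M := P) (continuous2_diff cont_f).
    have qx := continuous_qform (M := P) (continuous2_diff
      (F := id) (fun x => cvg_id)).
    have qc := continuous_qform (M := M) cc.
    by move=> z; exact: (cvgB (cvgD (cvgB (qh z) (qf z)) (qx z)) (qc z)).
  have cs : continuous2 (fun x xbar => const_mx (s x xbar) : 'cV_1).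
    apply: continuous_coord => i j; under eq_fun do rewrite mxE.
    by move=> z; exact: (continuous_comp (cg z) (@sqrt_continuous R _)).
  (* Facing a zero row, [s] contributes to [|ell|^2] alone. The extra row also keeps [k] positive
     when [m = 0]. *)
  exists (m + 1)%N, (col_mx W 0), (fun x xbar => col_mx (W *m c x xbar)
    (const_mx (s x xbar))).
  split; first by rewrite addn1.
  - apply: continuous_coord => i j; case: (split_ordP i) => i' ->.
      under eq_fun do rewrite col_mxEu.
      by apply: continuous_entry; exact: continuous_mulmxl.
    under eq_fun do rewrite col_mxEd.
    exact: continuous_entry cs.
  apply/eid_equationsP => // x xbar Exbar.
  have [Mc Mca] := quadratic_ge0 symM (fun v => pos x xbar v Exbar).
  rewrite -/(c x xbar) in Mc Mca.
  split.
  - rewrite sqnorm2E dot_col_mx dot_mull mulmxA WE -qformE dotE big_ord1 !mxE.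
    (* By [Mca], available over equilibria, [g] is nonnegative here, so the root squares back to
       it. *)
    by rewrite -expr2 sqr_sqrtr ?subr_ge0 // addrC subrK.
  - by rewrite tr_col_mx mul_row_col trmx0 mul0mx addr0 mulmxA WE.
  - by rewrite tr_col_mx mul_row_col trmx0 mul0mx addr0 WE.
- case=> k [W [ell [_ _ /eid_equationsP eqs]]] x xbar v Exbar.
  have [<- <- <-] := eqs symP x xbar Exbar.
  rewrite sqnorm2E dot_mull trmxK.
  have -> : qform (W^T *m W) v = dot (W *m v) (W *m v).
    by rewrite qformE dot_mull mulmxA.
  have := dot_ge0 (ell x xbar + W *m v).
  by rewrite !(dotDl, dotDr) [dot (W *m v) (ell _ _)]dotC; lra.
move=> k W ell _ c_ell /eid_equationsP-/(_ symP) eqs T /andP[_ /andP[_ kerT]].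
(* A generalized inverse: [W^T *m L *m W^T = W^T]. Below, [K] is one for [T]. *)
pose L := (pinvmx W)^T.
pose b x := (Qm *m sys_J Sys + Sm)^T *m sys_h Sys x - (sys_G Sys)^T *m P *m
  sys_f Sys x.
have diss_linE x xbar : diss_lin Sys Qm Sm P x xbar = b x - b xbar.
  by rewrite /diss_lin /b !mulmxBr !opprD !opprK addrACA.
pose l x := L *m b x; pose K := (pinvmx T^T)^T.
pose d x xbar := K *m (ell x xbar - (l x - l xbar)).
have dE x xbar : equilibria Sys xbar ->
    T *m d x xbar = ell x xbar - (l x - l xbar).
  move=> Exbar; have [_ Wl _] := eqs x xbar Exbar.
  (* [L] is applied to [b x - b xbar = W^T *m ell x xbar], which lies in the range of [W^T], so
     [W^T *m L] fixes it. *)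
  have Wk : W^T *m (ell x xbar - (l x - l xbar)) = 0.
    have -> : l x - l xbar = L *m (W^T *m ell x xbar)
      by rewrite Wl diss_linE mulmxBr.
    by rewrite mulmxBr !mulmxA -!trmx_mul mulmxA mulmxKpV ?subrr.
  apply: trmx_inj; rewrite !trmx_mul trmxK mulmxKpV //.
  apply: submx_trans kerT; apply/sub_kermxP.
  by apply: trmx_inj; rewrite trmx_mul !trmxK Wk trmx0.
have d0 x : equilibria Sys x -> d x x = 0.
  (* On the diagonal the constant term vanishes, and the first equation forces [ell x x = 0]. *)
  move=> Ex; have [e0 _ _] := eqs x x Ex.
  rewrite /d subrr subr0 (dot_eq0 (u := ell x x)) ?mulmx0 // -sqnorm2E e0.
  by rewrite /diss_const !subrr !qform0 !subrr addr0.
exists l, (fun x xbar => d x xbar - d xbar xbar); split=> [x|];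
  first by rewrite subrr.
split; last first.
  apply/eid_equationsP => // x xbar Exbar.
  by rewrite (d0 _ Exbar) subr0 dE // addrC subrK; exact: eqs.
have cl : continuous l.
  have cb := continuous_subr (continuous_mulmxl
    (A := (Qm *m sys_J Sys + Sm)^T) cont_h)
    (continuous_mulmxl (A := (sys_G Sys)^T *m P) cont_f).
  exact: continuous_mulmxl cb.
have cll := continuous2_diff cl.
have cd : continuous2 d := continuous_mulmxl (continuous_subr c_ell cll).
have cdd : continuous (fun z : 'cV[R]_n * 'cV[R]_n => d z.2 z.2).
  by move=> z; exact: (cvg_comp2 cvg_snd cvg_snd (cd (z.2, z.2))).
have cTd := continuous_mulmxl (A := T) (continuous_subr cd cdd).
by move=> z; exact: (cvgD (cll z) (cTd z)).
Qed.
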